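(* Let $\mathcal{L}=X_1^2+X_2^2+X_3^2$ be the sublaplacian of the three Brownian motions model on $\mathbb{R}^6$. The smooth vector fields on $\mathbb{R}^6$ which commute with $\mathcal{L}$ are exactly the linear combinations, with constant real coefficients, of the nine vector fields $\hat X_i,\theta_i,Y_i$ ($1\le i\le 3$). That is, $$\left\{X : X=\sum_{i=1}^3 (a_iX_i+b_iY_i)\ \text{with } a_i,b_i\in C^\infty(\mathbb{R}^6),\ [\mathcal{L},X]=0\right\}=\left\{\sum_{i=1}^3(\lambda_i\hat X_i+\mu_i\theta_i+\nu_iY_i) : \lambda_i,\mu_i,\nu_i\in\mathbb{R}\right\}.$$
   Context: Coordinates on $\mathbb{R}^6$ are $(x_1,x_2,x_3,y_1,y_2,y_3)$; indices are taken modulo $3$ in $\{1,2,3\}$; $\partial_i=\partial_{x_i}$, $\hat\partial_i=\partial_{y_i}$. For $1\le i\le 3$ define the vector fields $$X_i=\partial_i-\frac{x_{i+1}}{2}\hat\partial_{i+2}+\frac{x_{i+2}}{2}\hat\partial_{i+1},\qquad Y_i=\hat\partial_i,$$ $$\hat X_i=\partial_i+\frac{x_{i+1}}{2}\hat\partial_{i+2}-\frac{x_{i+2}}{2}\hat\partial_{i+1},$$ $$\theta_i=x_{i+1}\partial_{i+2}-x_{i+2}\partial_{i+1}+y_{i+1}\hat\partial_{i+2}-y_{i+2}\hat\partial_{i+1}.$$ The commutator $[\mathcal{L},X]=\mathcal{L}X-X\mathcal{L}$ is taken as differential operators acting on smooth functions. *)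

(* Defs.v *)
From mathcomp Require Import all_boot all_order all_algebra.
From mathcomp Require Import all_classical all_reals all_analysis.

Set Implicit Arguments.
Unset Strict Implicit.
Unset Printing Implicit Defensive.

Import Order.TTheory GRing.Theory Num.Theory.
Import numFieldNormedType.Exports.

Local Open Scope classical_set_scope.
Local Open Scope ring_scope.

(* The point (x_1,x_2,x_3,y_1,y_2,y_3) is a row vector whose columns 0,1,2
   hold the x_i and 3,4,5 the y_i.  The index set {1,2,3} modulo 3 is rendered
   by 'I_3, where i + 1 and i + 2 are computed modulo 3. *)
Definition xi (i : 'I_3) : 'I_6 := lshift 3 i.
Definition yi (i : 'I_3) : 'I_6 := rshift 3 i.

Section ThreeBrownianMotions.
Variable R : realType.

Definition evec (j : 'I_6) : 'rV[R]_6 := delta_mx 0 j.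

Definition partial (j : 'I_6) (f : 'rV[R]_6 -> R) : 'rV[R]_6 -> R :=
  fun p => 'D_(evec j) f p.

Definition iter_partial (s : seq 'I_6) (f : 'rV[R]_6 -> R) : 'rV[R]_6 -> R :=
  foldr partial f s.

(* f is C^oo: all its partial derivatives of all orders exist and are
   continuous.  Existence is required explicitly since 'D_v is total. *)
Definition smooth (f : 'rV[R]_6 -> R) : Prop :=
  forall s : seq 'I_6,
    continuous (iter_partial s f) /\
    forall (j : 'I_6) (p : 'rV[R]_6), derivable (iter_partial s f) p (evec j).

(* A vector field is given by its components in the frame of coordinate vector
   fields d/dx_1, ..., d/dy_3. *)
Definition vfield := 'rV[R]_6 -> 'rV[R]_6.

Definition smooth_vfield (X : vfield) : Prop :=
  forall j : 'I_6, smooth (fun p => X p 0 j).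

Definition operator := ('rV[R]_6 -> R) -> ('rV[R]_6 -> R).

Definition lie (X : vfield) : operator :=
  fun f p => \sum_(j < 6) X p 0 j * partial j f p.

Definition commutator (A B : operator) : operator :=
  fun f p => A (B f) p - B (A f) p.

Definition dx (i : 'I_3) : vfield := fun=> evec (xi i).
Definition dy (i : 'I_3) : vfield := fun=> evec (yi i).
Definition x_ (i : 'I_3) (p : 'rV[R]_6) : R := p 0 (xi i).
Definition y_ (i : 'I_3) (p : 'rV[R]_6) : R := p 0 (yi i).

Definition X_ (i : 'I_3) : vfield := fun p =>
  dx i p - (x_ (i + 1) p / 2) *: dy (i + 2) p
         + (x_ (i + 2) p / 2) *: dy (i + 1) p.

Definition Y_ (i : 'I_3) : vfield := dy i.

Definition Xhat_ (i : 'I_3) : vfield := fun p =>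
  dx i p + (x_ (i + 1) p / 2) *: dy (i + 2) p
         - (x_ (i + 2) p / 2) *: dy (i + 1) p.

Definition theta_ (i : 'I_3) : vfield := fun p =>
  x_ (i + 1) p *: dx (i + 2) p - x_ (i + 2) p *: dx (i + 1) p
  + y_ (i + 1) p *: dy (i + 2) p - y_ (i + 2) p *: dy (i + 1) p.

Definition sublaplacian : operator :=
  fun f p => \sum_(i < 3) lie (X_ i) (lie (X_ i) f) p.

(* [L, X] = 0 as operators on C^oo(R^6). *)
Definition commutes_with_sublaplacian (X : vfield) : Prop :=
  forall f : 'rV[R]_6 -> R, smooth f ->
  forall p : 'rV[R]_6, commutator sublaplacian (lie X) f p = 0.

Definition in_frame_span (X : vfield) : Prop :=
  exists a b : 'I_3 -> 'rV[R]_6 -> R,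
    [/\ forall i, smooth (a i), forall i, smooth (b i) &
        X = fun p => \sum_(i < 3) (a i p *: X_ i p + b i p *: Y_ i p)].

Definition in_const_span (X : vfield) : Prop :=
  exists lambda mu nu : 'I_3 -> R,
    X = fun p => \sum_(i < 3)
      (lambda i *: Xhat_ i p + mu i *: theta_ i p + nu i *: Y_ i p).

End ThreeBrownianMotions.

(* Main.v *)
From HB Require Import structures.
Require Import Defs.
From mathcomp Require Import all_boot all_order all_algebra.
From mathcomp Require Import all_classical all_reals all_analysis.
From mathcomp Require Import ring.

(* A derivation Z commuting with L differentiates the carre du champ
   L(fg) - f L g - g L f = 2 sum_i X_i f X_i g by the Leibniz rule.  On the
   coordinates this yields, for a_i = Z x_i and the vertical coefficients b_k of
   Z in the frame X, Y, the equations
     X_j a_k + X_k a_j = 0   and   X_j b_k = sum_i eps_(ijk) a_i.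
   As Y_i = [X_(i+1), X_(i+2)], they give Y_i b_j = - X_j a_i, and all Y_i a_i
   are equal to one function s with s = - 2 s, hence s = 0.  So the X_j a_i are
   annihilated by the frame, i.e. constant: subtracting a combination of the
   rotations and of the Xhat_i kills a, and then b is constant.  Conversely,
   L commutes with Xhat_i and Y_i, which commute with each X_j, and with the
   rotations theta_i, which act on (X_1, X_2, X_3) by skew matrices. *)

Set Implicit Arguments.
Unset Strict Implicit.
Unset Printing Implicit Defensive.

Import Order.TTheory GRing.Theory Num.Theory.
Import numFieldNormedType.Exports.

Local Open Scope classical_set_scope.
Local Open Scope ring_scope.

(** * Calculus along lines *)

Section DirectionalDerivatives.
Variables (R : realType) (V : normedModType R).
Implicit Types (f : V -> R) (u v p : V).

Lemma is_derive_line f v p (t : R) : derivable f (t *: v + p) v ->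
  is_derive t (1 : R) (fun s : R => f (s *: v + p)) ('D_v f (t *: v + p)).
Proof.
have E : (fun h : R => h^-1 *:
      (((fun s : R => f (s *: v + p)) \o shift t) (h *: (1 : R))
       - f (t *: v + p))) =
  (fun h : R => h^-1 *: ((f \o shift (t *: v + p)) (h *: v) - f (t *: v + p))).
  by apply/funext => h /=; rewrite [h *: (1 : R)]mulr1 scalerDl addrA.
by move=> fv; split; rewrite /derivable /derive E.
Qed.

Lemma MVT_line f v p (h : R) : 0 < h -> (forall q, derivable f q v) ->
  exists2 c : R, 0 < c < h & f (h *: v + p) - f p = 'D_v f (c *: v + p) * h.
Proof.
move=> h0 fv.
have df (t : R) := is_derive_line (fv (t *: v + p)).
have [|c + E] := MVT h0 (fun x _ => df x).
  apply: derivable_within_continuous => x _; exact: ex_derive.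
rewrite in_itv/= => ch; exists c => //.
by move: E; rewrite scale0r add0r subr0.
Qed.

Lemma derive0_line f v p (h : R) : (forall q, derivable f q v) ->
  (forall q, 'D_v f q = 0) -> f (h *: v + p) = f p.
Proof.
move=> fv f0.
have df (t : R) : is_derive t (1 : R) (fun s : R => f (s *: v + p)) 0.
  by rewrite -(f0 (t *: v + p)); exact: is_derive_line.
by rewrite (is_derive_0_is_cst h 0 df) scale0r add0r.
Qed.

Lemma is_derive_shift f v w p : derivable f (w + p) v ->
  is_derive p v (fun q => f (w + q)) ('D_v f (w + p)).
Proof.
have E : (fun h : R => h^-1 *: (((fun q => f (w + q)) \o shift p) (h *: v)
            - f (w + p))) =
  (fun h : R => h^-1 *: ((f \o shift (w + p)) (h *: v) - f (w + p))).
  by apply/funext => h /=; rewrite addrCA.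
by move=> fv; split; rewrite /derivable /derive E.
Qed.

(** The mean value theorem is used twice: along [u] for the increment [g] of [f] in direction
    [h *: v], then along [v] for ['D_u f]. *)
Lemma second_difference f u v p (h : R) : 0 < h ->
    (forall q, derivable f q u) -> (forall q, derivable ('D_u f) q v) ->
  exists c d : R, [/\ 0 < c < h, 0 < d < h &
    f (h *: u + (h *: v + p)) - f (h *: u + p) - f (h *: v + p) + f p =
    'D_v ('D_u f) (c *: u + (d *: v + p)) * h ^+ 2].
Proof.
move=> h0 fu fuv.
pose g q := f (h *: v + q) - f q.
have E q : is_derive q u g ('D_u f (h *: v + q) - 'D_u f q).
  have -> : g = (fun q => f (h *: v + q)) - f by [].
  exact: (is_deriveB (is_derive_shift (fu _)) (derivableP (fu q))).
have [|c ch Ec] := @MVT_line g u p h h0; first by move=> q; exact: ex_derive.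
have [d dh Ed] := @MVT_line ('D_u f) v (c *: u + p) h h0 fuv.
exists c, d; split=> //.
move: Ec; rewrite derive_val /g Ed (addrCA _ (c *: u)) expr2 mulrA => <-.
by rewrite (addrCA (h *: v)); ring.
Qed.

(** A triangle inequality at [p]. The two sample points may differ, as do those given by the mean
    value theorem for the two orders of differentiation. *)
Lemma continuous_agree_near (F G : V -> R) p :
    {for p, continuous F} -> {for p, continuous G} ->
    (forall r : R, 0 < r ->
      exists q q', [/\ `|q| < r, `|q'| < r & F (q + p) = G (q' + p)]) ->
  F p = G p.
Proof.
move=> cF cG FG; apply/eqP; rewrite -subr_eq0 -normr_le0.
apply/ler_addgt0Pr => e e0; rewrite add0r.
have e20 : 0 < e / 2 by rewrite divr_gt0.
move/cvgrPdist_lt : cF => /(_ _ e20) /nbhs_ballP[r1 /= r10 H1].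
move/cvgrPdist_lt : cG => /(_ _ e20) /nbhs_ballP[r2 /= r20 H2].
have [|q [q' [+ + E]]] := FG (Num.min r1 r2); first by rewrite lt_min r10.
have ballp y r : `|y| < r -> ball p r (y + p).
  by rewrite -ball_normE/= opprD addrCA subrr addr0 normrN.
rewrite !lt_min => /andP[/ballp /H1 + _] /andP[_ /ballp /H2].
rewrite E => A B.
rewrite -(subrKA (G (q' + p))) (le_trans (ler_normD _ _))// [leRHS]splitr.
by rewrite lerD// ltW// distrC.
Qed.

(** The second difference of [f] is symmetric in [u] and [v], so the two mixed derivatives take a
    common value at points arbitrarily close to [p]; continuity concludes. *)
Lemma Schwarz_theorem f u v p :
    (forall q, derivable f q u) -> (forall q, derivable f q v) ->
    (forall q, derivable ('D_u f) q v) -> (forall q, derivable ('D_v f) q u) ->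
    {for p, continuous ('D_v ('D_u f))} ->
    {for p, continuous ('D_u ('D_v f))} ->
  'D_v ('D_u f) p = 'D_u ('D_v f) p.
Proof.
move=> fu fv fuv fvu cuv cvu; apply: (continuous_agree_near cuv cvu) => r r0.
(* The summand 1 keeps [N] positive when [u] and [v] vanish and makes the bound by [h * N = r]
   strict. *)
pose N := 1 + `|u| + `|v|.
have N0 : 0 < N by rewrite /N -addrA ltr_pwDl// addr_ge0.
pose h := r / N.
have h0 : 0 < h by rewrite divr_gt0.
have small (c d : R) : 0 < c < h -> 0 < d < h -> `|c *: u + d *: v| < r.
  move=> /andP[c0 ch] /andP[d0 dh].
  have -> : r = h * N by rewrite divfK// gt_eqF.
  apply: le_lt_trans (ler_normD _ _) _; rewrite !normrZ !gtr0_norm// /N.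
  by rewrite !mulrDr mulr1 -addrA ltr_pwDl// lerD// ler_wpM2r// ltW.
have [c [d [ch dh E1]]] := second_difference p h0 fu fuv.
have [d' [c' [dh' ch' E2]]] := second_difference p h0 fv fvu.
exists (c *: u + d *: v), (d' *: v + c' *: u); split.
- exact: small.
- by rewrite addrC; exact: small.
rewrite -!addrA; apply: (@mulIf _ (h ^+ 2)).
  by rewrite expf_neq0// gt_eqF.
apply: (etrans (esym E1)); apply: etrans E2.
by rewrite (addrCA (h *: v) (h *: u) p) (addrAC (f _)).
Qed.
End DirectionalDerivatives.

(** * Commuting derivations in a differential ring *)

Section CyclicIndices.
Implicit Types i j : 'I_3.

Lemma I3_add11 i : i + 1 + 1 = i + 2.
Proof. by apply/val_inj; case: i => [[|[|[|]]]]. Qed.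

Lemma I3_add12 i : i + 1 + 2 = i.
Proof. by apply/val_inj; case: i => [[|[|[|]]]]. Qed.

Lemma I3_add21 i : i + 2 + 1 = i.
Proof. by apply/val_inj; case: i => [[|[|[|]]]]. Qed.

Lemma I3_add22 i : i + 2 + 2 = i + 1.
Proof. by apply/val_inj; case: i => [[|[|[|]]]]. Qed.

Definition I3_addE := (I3_add11, I3_add12, I3_add21, I3_add22).

Lemma I3_eqE i : ((i == i + 1) = false) * ((i == i + 2) = false) *
  ((i + 1 == i) = false) * ((i + 1 == i + 2) = false) *
  ((i + 2 == i) = false) * ((i + 2 == i + 1) = false).
Proof. by case: i => [[|[|[|]]]]. Qed.

Lemma I3_case i j : [\/ j = i, j = i + 1 | j = i + 2].
Proof.
case: i j => [[|[|[|//]]] ?] [[|[|[|//]]] ?];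
  by [apply: Or31; apply/val_inj | apply: Or32; apply/val_inj
     |apply: Or33; apply/val_inj].
Qed.

Lemma sum_I3 (V : zmodType) (F : 'I_3 -> V) i :
  \sum_j F j = F i + F (i + 1) + F (i + 2).
Proof.
rewrite (bigD1 i)//= (bigD1 (i + 1)) ?I3_eqE//= (bigD1 (i + 2)) ?I3_eqE//=.
rewrite big1 ?addr0 ?addrA// => j; have [] := I3_case i j => ->;
  by rewrite ?I3_addE eqxx ?andbF.
Qed.

End CyclicIndices.

(** * Derivations of a ring and sums of their squares *)

Definition derivation (A : pzRingType) (D : A -> A) : Prop :=
  (forall f g, D (f + g) = D f + D g) /\
  (forall f g, D (f * g) = D f * g + f * D g).

Section Derivations.
Variables (A : pzRingType) (D : A -> A).
Hypothesis derD : derivation D.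

Lemma derivation0 : D 0 = 0.
Proof. by apply: (addrI (D 0)); rewrite -(proj1 derD) !addr0. Qed.

Lemma derivationN f : D (- f) = - D f.
Proof. by apply/eqP; rewrite -addr_eq0 -(proj1 derD) addNr derivation0. Qed.

Lemma derivation1 : D 1 = 0.
Proof.
have := proj2 derD 1 1; rewrite !mulr1 mul1r => E.
by apply: (addrI (D 1)); rewrite -E addr0.
Qed.

Lemma derivation_nat n : D n%:R = 0.
Proof.
elim: n => [|n IHn]; first exact: derivation0.
by rewrite -natr1 (proj1 derD) IHn derivation1 addr0.
Qed.

Lemma derivation_sum I (r : seq I) (F : I -> A) :
  D (\sum_(i <- r) F i) = \sum_(i <- r) D (F i).
Proof.
elim/big_ind2: _ => [|f a g b <- <-|//]; first exact: derivation0.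
exact: (proj1 derD).
Qed.

(** Multiplying [D h + D h = 0] by [h] and using [h + h = 1] isolates [D h]. *)
Lemma derivation_half h : h + h = 1 -> D h = 0.
Proof.
move=> hD; have Dh : D h + D h = 0 by rewrite -(proj1 derD) hD derivation1.
by rewrite -[D h]mulr1 -hD mulrDr -mulrDl Dh mul0r.
Qed.

Lemma derivation_sqrM f g :
  D (D (f * g)) = D (D f) * g + f * D (D g) + (D f * D g) *+ 2.
Proof.
rewrite (proj2 derD) (proj1 derD) !(proj2 derD) mulr2n.
by rewrite -!addrA; congr (_ + _); rewrite [LHS]addrA addrC.
Qed.

End Derivations.

Definition sum_squares (A : nmodType) (X : 'I_3 -> A -> A) f :=
  \sum_i X i (X i f).

Lemma sum_squaresD (A : pzRingType) (X : 'I_3 -> A -> A) f g :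
    (forall i, derivation (X i)) ->
  sum_squares X (f + g) = sum_squares X f + sum_squares X g.
Proof.
move=> derX; rewrite /sum_squares -big_split; apply: eq_bigr => i _ /=.
by rewrite !(derX i).1.
Qed.

(** The last term is twice the carre du champ, through which the second-order operator gives access
    to the first-order frame. *)
Lemma sum_squaresM (A : comPzRingType) (X : 'I_3 -> A -> A) f g :
    (forall i, derivation (X i)) ->
  sum_squares X (f * g) = sum_squares X f * g + f * sum_squares X g
                          + (\sum_i X i f * X i g) *+ 2.
Proof.
move=> derX; rewrite /sum_squares mulr_suml mulr_sumr -sumrMnl -!big_split/=.
by apply: eq_bigr => i _; exact: derivation_sqrM.
Qed.

(** * Equations satisfied by a derivation commuting with the sum of squares *)

Section CommutingDerivation.
Variables (A : comNzRingType) (half : A) (x y : 'I_3 -> A).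
Variables (X Y : 'I_3 -> A -> A).
Hypothesis halfD : half + half = 1.
Hypothesis torsion_free : forall n (f : A), f *+ n.+1 = 0 -> f = 0.
Hypothesis derX : forall i, derivation (X i).
Hypothesis derY : forall i, derivation (Y i).
Hypothesis X_Y : forall i j f, X i (Y j f) = Y j (X i f).
Hypothesis X_bracket : forall i f,
  X (i + 1) (X (i + 2) f) = X (i + 2) (X (i + 1) f) + Y i f.
Hypothesis X_x : forall i j, X i (x j) = (i == j)%:R.
Hypothesis X_y : forall i j, X i (y j) =
  half * x (i + 2) * (i + 1 == j)%:R - half * x (i + 1) * (i + 2 == j)%:R.
Implicit Types (i j k : 'I_3) (f g : A).
Local Notation sublap := (sum_squares X).

Let YE i f : Y i f = X (i + 1) (X (i + 2) f) - X (i + 2) (X (i + 1) f).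
Proof. by rewrite X_bracket addrAC subrr add0r. Qed.

Let double_eq0 f : f + f = 0 -> f = 0.
Proof. by move=> f0; apply: (@torsion_free 1); rewrite mulr2n. Qed.

Variable Z : A -> A.
Hypothesis derZ : derivation Z.
Hypothesis sublapZ : forall f, sublap (Z f) = Z (sublap f).

(** Expanding [sublapZ (f * g)] by the product rule cancels every term containing [sublap] and
    leaves twice this identity. *)
Let carre_du_champ f g :
  \sum_i (X i (Z f) * X i g + X i f * X i (Z g)) = \sum_i Z (X i f * X i g).
Proof.
have := sublapZ (f * g).
rewrite sum_squaresM// !derZ.2 sum_squaresD// !sum_squaresM// derZ.1 derZ.1.
rewrite !derZ.2 !sublapZ.
rewrite mulr2n derZ.1 -mulr2n -(derivation_sum derZ) big_split/= => E.
apply/eqP; rewrite -subr_eq0; apply/eqP; apply: (@torsion_free 1).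
move/eqP: E; rewrite -subr_eq0 => /eqP; apply: etrans; ring.
Qed.

Let a i := Z (x i).
(** The skew matrix of the [X j (a k)] read as an axial vector; [slope i] becomes the coefficient of
    the rotation about axis [i]. *)
Let slope i := X (i + 1) (a (i + 2)).
(* The coefficient of [Y k] when [Z] is written in the frame [X], [Y]. *)
Let b k :=
  Z (y k) + half * a (k + 1) * x (k + 2) - half * a (k + 2) * x (k + 1).

Let sum_delta j (F : 'I_3 -> A) : \sum_i (i == j)%:R * F i = F j.
Proof. by rewrite (sum_I3 _ j) eqxx !I3_eqE /=; ring. Qed.

(** The products [X i (x j) * X i (x k)] are integers, killed by [Z], so the carre du champ identity
    for [x j] and [x k] has zero right-hand side. *)
Let Xa_skew j k : X j (a k) = - X k (a j).
Proof.
apply/eqP; rewrite -addr_eq0; apply/eqP.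
have := carre_du_champ (x j) (x k).
under eq_bigr do rewrite !X_x (mulrC (X _ _)).
rewrite big_split/= !sum_delta addrC => ->.
by rewrite big1// => i _; rewrite !X_x -natrM derivation_nat.
Qed.

Let Xa_diag i : X i (a i) = 0.
Proof. by apply: double_eq0; rewrite {1}Xa_skew addNr. Qed.

Let Zhalf : Z half = 0. Proof. exact: (derivation_half derZ halfD). Qed.

(** The carre du champ identity for [x j] and [y k], where skewness turns [X i (a j)] into
    [- X j (a i)]. *)
Let XZy j k : X j (Z (y k)) = Z (X j (y k)) + \sum_i X j (a i) * X i (y k).
Proof.
have := carre_du_champ (x j) (y k).
rewrite (eq_bigr (fun i => - (X j (a i) * X i (y k))
    + (i == j)%:R * X i (Z (y k)))); last first.
  by move=> i _; rewrite X_x -/(a j) Xa_skew mulNr.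
rewrite [in RHS](eq_bigr (fun i => (i == j)%:R * Z (X i (y k)))); last first.
  by move=> i _; rewrite derZ.2 X_x (derivation_nat derZ) mul0r add0r.
rewrite big_split/= !sum_delta sumrN => <-.
by rewrite addrAC addNr add0r.
Qed.

(** The terms [X j (a i) * X i (y k)] of [XZy] cancel against the correction in [b k]; what remains
    is the sum over [i] of [a i] times the bracket of [X i] and [X j] applied to [y k]. *)
Let Xb k : [/\ X k (b k) = 0, X (k + 1) (b k) = - a (k + 2) &
              X (k + 2) (b k) = a (k + 1)].
Proof.
have D i := derX i.
have half0 i := derivation_half (D i) halfD.
rewrite /b !(D _).1 !(derivationN (D _)) !(D _).2 !XZy !(sum_I3 _ k) !X_y !X_x.
rewrite !half0 !I3_addE !eqxx !I3_eqE !mulr0 !mulr1 !mul0r !addr0 !subr0 !sub0r.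
rewrite !(derivationN derZ) !derZ.2 Zhalf -!/(a _) (derivation0 derZ) !Xa_diag.
rewrite (Xa_skew (k + 2) (k + 1)) !(Xa_skew k).
(* [half] is opaque to [ring], so [half + half = 1] enters by splitting [a] into two halves. *)
have hD f : half * f + half * f = f by rewrite -mulrDl halfD mul1r.
split; first by ring.
- by rewrite -[in RHS](hD (a _)); ring.
- by rewrite -[RHS](hD (a _)); ring.
Qed.

(** [Y i] is the bracket of [X (i + 1)] and [X (i + 2)], whose action on [b j] is known from
    [Xb]. *)
Let Yb i j : Y i (b j) = - X j (a i).
Proof.
have [B0 B1 B2] := Xb j; rewrite YE.
have D k := derX k.
move: B0 B1 B2; have [] := I3_case i j => ->; rewrite ?I3_addE => B0 B1 B2.
- by rewrite B1 B2 (derivationN (D _)) !Xa_diag oppr0 subr0.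
- by rewrite B0 B1 (derivationN (D _)) (derivation0 (D _)); ring.
- by rewrite B0 B2 (derivation0 (D _)); ring.
Qed.

Let slopeE i : slope i = Y (i + 1) (b (i + 2)).
Proof. by rewrite Yb -Xa_skew. Qed.

Let slopeE' i : slope i = - Y (i + 2) (b (i + 1)).
Proof. by rewrite Yb opprK. Qed.

(** With the slope written by [slopeE] or [slopeE'], each [X j] passes through a [Y] and acts on
    some [b] by [Xb]. The two values of [X i (slope i)], taken for all [i], make the three
    [Y i (a i)] equal. *)
Let X_slope i : [/\ X i (slope i) = - Y (i + 1) (a (i + 1)),
  X i (slope i) = - Y (i + 2) (a (i + 2)),
  X (i + 1) (slope i) = 0 & X (i + 2) (slope i) = 0].
Proof.
have [B1 _ B1'] := Xb (i + 1); have [B2 B2' _] := Xb (i + 2).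
move: B1' B2'; rewrite !I3_addE => B1' B2'.
have D k := derX k.
split.
- by rewrite slopeE X_Y B2' (derivationN (derY _)).
- by rewrite slopeE' (derivationN (D _)) X_Y B1'.
- by rewrite slopeE' (derivationN (D _)) X_Y B1 (derivation0 (derY _)) oppr0.
- by rewrite slopeE X_Y B2 (derivation0 (derY _)).
Qed.

Let Ya i : Y i (a i) = 0.
Proof.
have [S0 S0' _ _] := X_slope i.
have [S1 S1' _ _] := X_slope (i + 1).
have [S2 S2' _ _] := X_slope (i + 2).
have E : Y i (a i) = X (i + 1) (slope (i + 1)) + X (i + 2) (slope (i + 2)).
  rewrite YE /slope !I3_addE (Xa_skew (i + 1) i).
  by rewrite (derivationN (derX _)) opprK.
(* The right-hand side of [E] is [- 2 Y i (a i)]. *)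
apply: (@torsion_free 2).
move: S1' S2; rewrite !I3_addE => S1' S2.
by rewrite mulrSr mulr2n -addrA [X in X + _]E S1' S2; ring.
Qed.

Let X_slope0 k i : X k (slope i) = 0.
Proof.
have [S0 _ S1 S2] := X_slope i.
by have [] := I3_case i k => ->; rewrite // S0 Ya oppr0.
Qed.

Lemma commuting_skew j k : X j (Z (x k)) = - X k (Z (x j)).
Proof. exact: Xa_skew. Qed.

(** Each [X j (Z (x i))] is zero or a slope up to sign. *)
Lemma commuting_slope i j k : X k (X j (Z (x i))) = 0.
Proof.
have [] := I3_case i j => ->.
- by rewrite -/(a i) Xa_diag (derivation0 (derX k)).
- have -> : X (i + 1) (Z (x i)) = - slope (i + 2).
    by rewrite /slope !I3_addE -Xa_skew.
  by rewrite (derivationN (derX k)) X_slope0 oppr0.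
- by have := X_slope0 k (i + 1); rewrite /slope !I3_addE.
Qed.

(** The subtracted terms are what the rotations weighted by the slopes do to [x i]; the remainder is
    the future coefficient of [frameXhat i]. *)
Lemma commuting_horizontal k i :
  X k (Z (x i) - X (i + 2) (Z (x i)) * x (i + 2)
       - X (i + 1) (Z (x i)) * x (i + 1)) = 0.
Proof.
have -> : X (i + 2) (Z (x i)) = slope (i + 1) by rewrite /slope !I3_addE.
have -> : X (i + 1) (Z (x i)) = - slope (i + 2).
  by rewrite /slope !I3_addE -Xa_skew.
rewrite mulNr opprK -/(a i) !(derX k).1 (derivationN (derX k)) !(derX k).2.
rewrite !X_slope0 !X_x /slope !I3_addE.
have [] := I3_case i k => ->;
  rewrite ?eqxx ?I3_eqE ?Xa_diag ?(Xa_skew (i + 1) i) /=; ring.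
Qed.

(** With all [Z (x i)] zero, [b k] reduces to [Z (y k)] and the right-hand sides of [Xb] vanish. *)
Lemma commuting_vertical :
  (forall i, Z (x i) = 0) -> forall j k, X j (Z (y k)) = 0.
Proof.
move=> a0 j k; have [B0 B1 B2] := Xb k.
have <- : b k = Z (y k) by rewrite /b /a !a0; ring.
have [] := I3_case k j => ->//.
- by rewrite B1 /a a0 oppr0.
- by rewrite B2 /a a0.
Qed.

End CommutingDerivation.

(* An algebraic model of the smooth functions on R^6: a commutative ring with
   commuting derivations [dx i], [dy i] dual to coordinates [x i], [y i]. *)
Section CoordinateCalculus.
Variables (A : comNzRingType) (half : A) (x y : 'I_3 -> A).
Variables (dx dy : 'I_3 -> A -> A).
Hypothesis halfD : half + half = 1.
Hypothesis derx : forall i, derivation (dx i).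
Hypothesis dery : forall i, derivation (dy i).
Hypothesis dx_x : forall i j, dx i (x j) = (i == j)%:R.
Hypothesis dx_y : forall i j, dx i (y j) = 0.
Hypothesis dy_x : forall i j, dy i (x j) = 0.
Hypothesis dy_y : forall i j, dy i (y j) = (i == j)%:R.
Hypothesis dxC : forall i j f, dx i (dx j f) = dx j (dx i f).
Hypothesis dyC : forall i j f, dy i (dy j f) = dy j (dy i f).
Hypothesis dydxC : forall i j f, dy i (dx j f) = dx j (dy i f).
Implicit Types (i j k : 'I_3) (f g : A).

Let dxD i f g : dx i (f + g) = dx i f + dx i g. Proof. exact: (derx i).1. Qed.
Let dyD i f g : dy i (f + g) = dy i f + dy i g. Proof. exact: (dery i).1. Qed.
Let dxM i f g : dx i (f * g) = dx i f * g + f * dx i g.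
Proof. exact: (derx i).2. Qed.
Let dyM i f g : dy i (f * g) = dy i f * g + f * dy i g.
Proof. exact: (dery i).2. Qed.
Let dxN i f : dx i (- f) = - dx i f. Proof. exact: derivationN. Qed.
Let dyN i f : dy i (- f) = - dy i f. Proof. exact: derivationN. Qed.

Let dx_half i : dx i half = 0.
Proof. exact: (derivation_half (derx i) halfD). Qed.
Let dy_half i : dy i half = 0.
Proof. exact: (derivation_half (dery i) halfD). Qed.

Definition frameX i f :=
  dx i f - half * x (i + 1) * dy (i + 2) f + half * x (i + 2) * dy (i + 1) f.

Definition frameXhat i f :=
  dx i f + half * x (i + 1) * dy (i + 2) f - half * x (i + 2) * dy (i + 1) f.

Definition rotation i f :=
  x (i + 1) * dx (i + 2) f - x (i + 2) * dx (i + 1) f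
  + y (i + 1) * dy (i + 2) f - y (i + 2) * dy (i + 1) f.

Let expandE := (dxD, dyD, dxM, dyM, dxN, dyN, dx_half, dy_half,
  dx_x, dx_y, dy_x, dy_y).

Lemma derivation_frameX i : derivation (frameX i).
Proof. by split=> f g; rewrite /frameX !expandE; ring. Qed.

Lemma derivation_frameXhat i : derivation (frameXhat i).
Proof. by split=> f g; rewrite /frameXhat !expandE; ring. Qed.

Lemma derivation_rotation i : derivation (rotation i).
Proof. by split=> f g; rewrite /rotation !expandE; ring. Qed.

Lemma frameX_dy i j f : frameX i (dy j f) = dy j (frameX i f).
Proof. by rewrite /frameX !expandE !dydxC !(dyC j); ring. Qed.

Lemma frameX_bracket i f :
  frameX (i + 1) (frameX (i + 2) f) =
  frameX (i + 2) (frameX (i + 1) f) + dy i f.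
Proof.
(* Writing [dy i f] as [(half + half) * dy i f] and ordering the second derivatives leaves an
   identity for [ring]. *)
rewrite -[dy i f]mul1r -halfD /frameX !I3_addE !expandE !I3_eqE !eqxx !dydxC.
rewrite (dxC (i + 2)) !(dyC (i + 1) i) !(dyC (i + 2)) /=.
ring.
Qed.

(** On R^6 these are the left- and right-invariant fields of the free step-two nilpotent group on
    three generators, and such fields commute. *)
Lemma frameX_Xhat i j f :
  frameX i (frameXhat j f) = frameXhat j (frameX i f).
Proof.
rewrite /frameX /frameXhat !expandE !dydxC.
have [] := I3_case i j => ->; rewrite ?I3_addE ?eqxx ?I3_eqE.
- rewrite !(dyC (i + 2)) /=; ring.
- rewrite (dxC (i + 1)) !(dyC (i + 1)) !(dyC (i + 2) i) /=; ring.
- rewrite (dxC (i + 2)) !(dyC (i + 1)) !(dyC (i + 2) i) /=; ring.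
Qed.

Lemma frameX_rotation i f :
  [/\ frameX i (rotation i f) = rotation i (frameX i f),
      frameX (i + 1) (rotation i f) =
        rotation i (frameX (i + 1) f) + frameX (i + 2) f &
      frameX (i + 2) (rotation i f) =
        rotation i (frameX (i + 2) f) - frameX (i + 1) f].
Proof.
rewrite /frameX /rotation !I3_addE !expandE !I3_eqE !eqxx !dydxC.
rewrite !(dxC (i + 1) i) !(dxC (i + 2)) !(dyC (i + 1) i) !(dyC (i + 2)) /=.
split; ring.
Qed.

Local Notation X := frameX.
Local Notation sublap := (sum_squares X).

Lemma sublap_Xhat j f : sublap (frameXhat j f) = frameXhat j (sublap f).
Proof.
rewrite /sum_squares (derivation_sum (derivation_frameXhat j)).
by apply: eq_bigr => i _; rewrite !frameX_Xhat.
Qed.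

Lemma sublap_dy j f : sublap (dy j f) = dy j (sublap f).
Proof.
rewrite /sum_squares (derivation_sum (dery j)).
by apply: eq_bigr => i _; rewrite !frameX_dy.
Qed.

(** By skewness, the symmetrised product of [X (i + 1)] and [X (i + 2)] appears with opposite signs
    in two of the squares and cancels. *)
Lemma sublap_rotation i f : sublap (rotation i f) = rotation i (sublap f).
Proof.
have [R0 R1 R2] := frameX_rotation i f.
have [_ S1 _] := frameX_rotation i (X (i + 1) f).
have [_ _ S2] := frameX_rotation i (X (i + 2) f).
have [S0 _ _] := frameX_rotation i (X i f).
have D k := derivation_frameX k; have T := derivation_rotation i.
rewrite /sum_squares !(sum_I3 _ i) R0 R1 R2 (D (i + 1)).1 (D (i + 2)).1.
rewrite (derivationN (D (i + 2))) S0 S1 S2 !T.1.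
ring.
Qed.

Lemma frameX_x i j : X i (x j) = (i == j)%:R.
Proof. by rewrite /frameX dx_x !dy_x !mulr0 subr0 addr0. Qed.

Lemma frameX_y i j : X i (y j) =
  half * x (i + 2) * (i + 1 == j)%:R - half * x (i + 1) * (i + 2 == j)%:R.
Proof. by rewrite /frameX dx_y !dy_y; ring. Qed.

Definition dconstant f := forall i, dx i f = 0 /\ dy i f = 0.

(** The frame is bracket generating: brackets of the [X i] give every [dy i], after which [X i f]
    reduces to [dx i f]. *)
Lemma frameX_eq0 f : (forall i, X i f = 0) -> dconstant f.
Proof.
move=> Xf0 i.
have dyf0 k : dy k f = 0.
  have := frameX_bracket k f.
  by rewrite !Xf0 !(derivation0 (derivation_frameX _)) add0r.
split=> //; have := Xf0 i.
by rewrite /frameX !dyf0 !mulr0 subr0 addr0.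
Qed.

Let X_constant i c : dconstant c -> X i c = 0.
Proof.
move=> cc; have [cx _] := cc i; have [_ c1] := cc (i + 1).
have [_ c2] := cc (i + 2).
by rewrite /frameX cx c1 c2 !mulr0 subr0 addr0.
Qed.

Let XM i f g : X i (f * g) = X i f * g + f * X i g.
Proof. exact: (derivation_frameX i).2. Qed.

Let sublapD f g : sublap (f + g) = sublap f + sublap g.
Proof. by apply: sum_squaresD => i; exact: derivation_frameX. Qed.

Let sublapZ c f : dconstant c -> sublap (c * f) = c * sublap f.
Proof.
move=> cc; rewrite /sum_squares mulr_sumr; apply: eq_bigr => i _.
by rewrite (XM i c f) (X_constant i cc) mul0r add0r XM (X_constant i cc) mul0r
  add0r.
Qed.

(** The coefficients are ring elements, as the model has no field of scalars; constancy is imposed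
    through [dconstant]. *)
Definition symmetry_comb (l m n : 'I_3 -> A) f :=
  \sum_i (l i * frameXhat i f + m i * rotation i f + n i * dy i f).

Lemma derivation_symmetry l m n : derivation (symmetry_comb l m n).
Proof.
split=> f g; rewrite /symmetry_comb.
  rewrite -big_split; apply: eq_bigr => i _ /=.
  rewrite (derivation_frameXhat i).1 (derivation_rotation i).1 dyD; ring.
rewrite mulr_suml mulr_sumr -big_split; apply: eq_bigr => i _ /=.
rewrite (derivation_frameXhat i).2 (derivation_rotation i).2 dyM; ring.
Qed.

Lemma sublap_symmetry l m n f : (forall i, dconstant (l i)) ->
    (forall i, dconstant (m i)) -> (forall i, dconstant (n i)) ->
  sublap (symmetry_comb l m n f) = symmetry_comb l m n (sublap f).
Proof.
move=> cl cm cn; rewrite /symmetry_comb !(sum_I3 _ 0) !sublapD !sublapZ//.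
by rewrite !sublap_Xhat !sublap_rotation !sublap_dy.
Qed.

Lemma symmetry_x l m n j : symmetry_comb l m n (x j) =
  l j + m (j + 1) * x (j + 2) - m (j + 2) * x (j + 1).
Proof.
rewrite /symmetry_comb (sum_I3 _ j) /frameXhat /rotation !I3_addE !dx_x !dy_x.
rewrite !eqxx !I3_eqE /=; ring.
Qed.

(** This isolates [n]: it is read off on the [y j] once the part given by [l] and [m] is removed. *)
Lemma symmetry_y l m n j : symmetry_comb l m n (y j) =
  symmetry_comb l m (fun=> 0) (y j) + n j.
Proof.
rewrite /symmetry_comb !(sum_I3 _ j) !dy_y eqxx !I3_eqE /=; ring.
Qed.

Hypothesis torsion_free : forall n (f : A), f *+ n.+1 = 0 -> f = 0.

(** Agreement on coordinates is enough to identify a vector field. The action on the [x i] yields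
    [l] and [m]; after subtracting that part, the rest annihilates the [x i], so its values on the
    [y i] are constants and serve as [n]. *)
Theorem commuting_derivation Z : derivation Z ->
    (forall f, sublap (Z f) = Z (sublap f)) ->
  exists l m n, [/\ forall i, dconstant (l i), forall i, dconstant (m i),
    forall i, dconstant (n i) &
    forall i, Z (x i) = symmetry_comb l m n (x i) /\
              Z (y i) = symmetry_comb l m n (y i)].
Proof.
move=> derZ sZ.
have skew := commuting_skew torsion_free derivation_frameX frameX_x derZ sZ.
have slope := commuting_slope halfD torsion_free derivation_frameX dery
  frameX_dy frameX_bracket frameX_x frameX_y derZ sZ.
have horiz := commuting_horizontal halfD torsion_free derivation_frameX dery
  frameX_dy frameX_bracket frameX_x frameX_y derZ sZ.
pose l i := Z (x i) - X (i + 2) (Z (x i)) * x (i + 2)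
            - X (i + 1) (Z (x i)) * x (i + 1).
pose m i := X (i + 1) (Z (x (i + 2))).
have cl i : dconstant (l i) by apply: frameX_eq0 => k; exact: horiz.
have cm i : dconstant (m i) by apply: frameX_eq0 => k; exact: slope.
have c0 i : dconstant 0.
  by move=> k; rewrite (derivation0 (derx k)) (derivation0 (dery k)).
(* [n] is arbitrary here, since the [dy i] annihilate the [x j]. *)
have Zx n i : Z (x i) = symmetry_comb l m n (x i).
  by rewrite symmetry_x /l /m !I3_addE (skew i (i + 1)); ring.
pose S := symmetry_comb l m (fun=> 0); pose Z' f := Z f - S f.
have derS : derivation S := derivation_symmetry _ _ _.
have derZ' : derivation Z'.
  by split=> f g; rewrite /Z' ?derZ.1 ?derZ.2 ?derS.1 ?derS.2; ring.
have sZ' f : sublap (Z' f) = Z' (sublap f).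
  have sS : sublap (S f) = S (sublap f) by exact: sublap_symmetry.
  rewrite /Z' sublapD -sZ -sS; congr (_ + _).
  rewrite -mulN1r sublapZ ?mulN1r// => k.
  by rewrite !derivationN// !derivation1// oppr0.
have Z'x i : Z' (x i) = 0 by rewrite /Z' (Zx (fun=> 0)) subrr.
have vert := commuting_vertical halfD torsion_free derivation_frameX
  frameX_x frameX_y derZ' sZ' Z'x.
exists l, m, (fun i => Z' (y i)); split=> // i.
  by apply: frameX_eq0 => k; exact: vert.
by split=> //; rewrite symmetry_y addrC /Z' subrK.
Qed.

End CoordinateCalculus.

(** * The ring of smooth functions *)

Section SmoothFunctions.
Variable R : realType.
Implicit Types (f g : 'rV[R]_6 -> R) (p : 'rV[R]_6) (c : R).

Lemma smooth_continuous f : smooth f -> continuous f.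
Proof. by move=> /(_ [::])[]. Qed.

Lemma smooth_derivable f j p : smooth f -> derivable f p (evec R j).
Proof. by move=> /(_ [::])[]. Qed.

Lemma smooth_partial f j : smooth f -> smooth (partial j f).
Proof.
by move=> sf s; have := sf (s ++ [:: j]); rewrite /iter_partial foldr_cat.
Qed.

(** Induction on the list of derivatives keeps every iterated partial inside [P], so smoothness
    reduces to a one-step stability check. *)
Lemma smooth_coind (P : set ('rV[R]_6 -> R)) :
    (forall f, P f -> continuous f /\ forall j,
      (forall p, derivable f p (evec R j)) /\ P (partial j f)) ->
  forall f, P f -> smooth f.
Proof.
move=> Pstep f Pf s.
have {Pf} /Pstep[cf df] : P (iter_partial s f).
  by elim: s => //= j s /Pstep[_ /(_ j)[]].
by split=> // j p; have [] := df j.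
Qed.

Lemma partialD f g j : smooth f -> smooth g ->
  partial j (f + g) = partial j f + partial j g.
Proof.
by move=> sf sg; apply/funext => p; apply: deriveD; exact: smooth_derivable.
Qed.

Lemma partialM f g j : smooth f -> smooth g ->
  partial j (f * g) = f * partial j g + g * partial j f.
Proof.
by move=> sf sg; apply/funext => p; apply: deriveM; exact: smooth_derivable.
Qed.

Lemma partial_cst c j : partial j (cst c) = cst 0.
Proof. by apply/funext => p; rewrite /partial derive_cst. Qed.

Lemma is_derive_coord i j p :
  is_derive p (evec R j) (fun q => q 0 i) ((j == i)%:R : R).
Proof.
have cvg_d : (fun h : R => h^-1 *: (((fun q : 'rV[R]_6 => q 0 i) \o shift p)
    (h *: evec R j) - p 0 i)) @ 0^' --> ((j == i)%:R : R).
  (* The coordinate is linear, so the quotient is constant for nonzero [h]. *)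
  apply: cvg_near_cst; near=> h.
  rewrite /= !mxE eqxx /= addrK [_ *: _]mulrA mulVf ?mul1r ?(eq_sym i)//.
  by near: h; exact: nbhs_dnbhs_neq.
by split; [apply/cvg_ex; exists (j == i)%:R | exact: cvg_lim].
Unshelve. all: by end_near. Qed.

Lemma partial_coord i j :
  partial j (fun p : 'rV[R]_6 => p 0 i) = cst (j == i)%:R.
Proof.
apply/funext => p; have := is_derive_coord i j p => H.
by rewrite /partial derive_val.
Qed.

Lemma smooth_cst c : smooth (cst c).
Proof.
apply: (@smooth_coind [set f | exists c, f = cst c]); last by exists c.
move=> f [d ->]; split=> [|j]; first exact: cst_continuous.
split=> [p|]; first exact: derivable_cst.
by exists 0; exact: partial_cst.
Qed.

Lemma smooth_coord i : smooth (fun p : 'rV[R]_6 => p 0 i).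
Proof.
(* The class adjoins the coordinate to the smooth functions, which contain its constant partials. *)
apply: (@smooth_coind [set f | f = (fun p => p 0 i) \/ smooth f]); last by left.
move=> f [->|sf]; (split=> [|j]; last split=> [p|]).
- exact: coord_continuous.
- by have [] := is_derive_coord i j p.
- by right; rewrite partial_coord; exact: smooth_cst.
- exact: smooth_continuous.
- exact: smooth_derivable.
- by right; exact: smooth_partial.
Qed.

(* The algebra generated by the smooth functions is stable under [partial j], so
   [smooth_coind] applies to it and no iterated Leibniz formula is needed. *)
Inductive smooth_alg : ('rV[R]_6 -> R) -> Prop :=
| smooth_alg_smooth f of smooth f : smooth_alg f
| smooth_algD f g of smooth_alg f & smooth_alg g : smooth_alg (f + g)
| smooth_algM f g of smooth_alg f & smooth_alg g : smooth_alg (f * g).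

Lemma smooth_alg_sub f : smooth_alg f -> smooth f.
Proof.
apply: smooth_coind => {}f; elim=> {f}
  [f sf|f g _ [cf df] _ [cg dg]|f g sf [cf df] sg [cg dg]].
- split=> [|j]; first exact: smooth_continuous.
  split=> [p|]; first exact: smooth_derivable.
  by apply: smooth_alg_smooth; exact: smooth_partial.
- split=> [p|j]; first exact: (continuousD (cf p) (cg p)).
  have [dfj pf] := df j; have [dgj pg] := dg j.
  split=> [p|]; first exact: derivableD.
  have -> : partial j (f + g) = partial j f + partial j g.
    by apply/funext => p; exact: deriveD.
  exact: smooth_algD.
- split=> [p|j]; first exact: (continuousM (cf p) (cg p)).
  have [dfj pf] := df j; have [dgj pg] := dg j.
  split=> [p|]; first exact: derivableM.
  have -> : partial j (f * g) = f * partial j g + g * partial j f.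
    by apply/funext => p; exact: deriveM.
  by apply: smooth_algD; apply: smooth_algM.
Qed.

Lemma smoothD f g : smooth f -> smooth g -> smooth (f + g).
Proof.
by move=> sf sg; apply/smooth_alg_sub/smooth_algD; exact: smooth_alg_smooth.
Qed.

Lemma smoothM f g : smooth f -> smooth g -> smooth (f * g).
Proof.
by move=> sf sg; apply/smooth_alg_sub/smooth_algM; exact: smooth_alg_smooth.
Qed.

(** The boolean form makes the smooth functions a subtype that inherits the pointwise commutative
    ring structure. *)
Definition is_smooth f : bool := `[< smooth f >].

Lemma is_smooth_subring : subring_closed is_smooth.
Proof.
split=> [|f g /asboolP sf /asboolP sg|f g /asboolP sf /asboolP sg];
  apply/asboolP.
- exact: (smooth_cst 1).
- apply: smoothD => //; have -> : - g = cst (-1) * g.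
    by apply/funext => p /=; rewrite /GRing.mul/= mulN1r.
  by apply: smoothM => //; exact: smooth_cst.
- exact: smoothM.
Qed.

HB.instance Definition _ :=
  GRing.isSubringClosed.Build _ is_smooth is_smooth_subring.

Definition smooth_fun := {f : 'rV[R]_6 -> R | is_smooth f}.
HB.instance Definition _ := SubChoice.on smooth_fun.
HB.instance Definition _ := [SubChoice_isSubComNzRing of smooth_fun by <:].

Definition to_smooth f (sf : smooth f) : smooth_fun := Sub f (asboolT sf).

Lemma smoothP (F : smooth_fun) : smooth (val F).
Proof. exact/asboolP/(valP F). Qed.

Implicit Types F G : smooth_fun.

Definition der j F : smooth_fun := to_smooth (smooth_partial j (smoothP F)).
Definition const_fun c : smooth_fun := to_smooth (smooth_cst c).
Definition coord_fun i : smooth_fun := to_smooth (smooth_coord i).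


Lemma derivation_der j : derivation (der j).
Proof.
split=> F G; apply: val_inj; first exact: (partialD _ (smoothP F) (smoothP G)).
have -> : der j F * G + F * der j G = F * der j G + G * der j F.
  by rewrite addrC [_ * G]mulrC.
exact: (partialM _ (smoothP F) (smoothP G)).
Qed.

Lemma derC i j F : der i (der j F) = der j (der i F).
Proof.
apply: val_inj; apply/funext => p; have sF := smoothP F.
apply: Schwarz_theorem => [q|q|q|q||].
- exact: smooth_derivable.
- exact: smooth_derivable.
- by apply: smooth_derivable; exact: smooth_partial.
- by apply: smooth_derivable; exact: smooth_partial.
- by apply: smooth_continuous; do 2 apply: smooth_partial.
- by apply: smooth_continuous; do 2 apply: smooth_partial.
Qed.

Lemma const1 : const_fun 1 = 1. Proof. exact: val_inj. Qed.

Lemma constD c d : const_fun (c + d) = const_fun c + const_fun d.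
Proof. exact: val_inj. Qed.

Lemma der_const j c : der j (const_fun c) = 0.
Proof. by apply: val_inj; exact: partial_cst. Qed.

Lemma der_coord i j : der j (coord_fun i) = (j == i)%:R.
Proof.
apply: val_inj; rewrite /= partial_coord.
by case: (j == i).
Qed.

Lemma smooth_torsion_free n F : F *+ n.+1 = 0 -> F = 0.
Proof.
move=> F0; apply: val_inj; apply/funext => p.
have : val (F *+ n.+1) p = 0 by rewrite F0.
have -> : val (F *+ n.+1) p = val F p *+ n.+1.
  by elim: n.+1 => // k IH; rewrite !mulrS -IH.
by move/eqP; rewrite mulrn_eq0/= => /eqP.
Qed.

(** Any [p] is reached from the origin by steps along the coordinate axes, each of which preserves
    [val F] by [derive0_line]. *)
Lemma der_eq0_const F : (forall j, der j F = 0) -> F = const_fun (val F 0).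
Proof.
move=> dF; apply: val_inj; apply/funext => p /=.
have dF0 j q : 'D_(evec R j) (val F) q = 0.
  by have := congr1 (fun G : smooth_fun => val G q) (dF j).
have step j h q : val F (h *: evec R j + q) = val F q.
  apply: derive0_line => // r; exact/smooth_derivable/smoothP.
rewrite [p in LHS]row_sum_delta; elim/big_rec: _ => // j q _.
by rewrite step.
Qed.

End SmoothFunctions.

(** * Vector fields on R^6 *)

Lemma eq_xi i j : (xi i == xi j) = (i == j).
Proof. exact: (@eq_lshift 3 3). Qed.

Lemma eq_yi i j : (yi i == yi j) = (i == j).
Proof. exact: (@eq_rshift 3 3). Qed.

Lemma eq_xi_yi i j : (xi i == yi j) = false.
Proof. exact: (@eq_lrshift 3 3). Qed.

Lemma index6P (j : 'I_6) : (exists i, j = xi i) \/ (exists i, j = yi i).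
Proof. by case: (@split_ordP 3 3 j) => i ->; [left | right]; exists i. Qed.

Section SublaplacianSymmetries.
Variable R : realType.
Implicit Types (F : smooth_fun R) (X : vfield R) (p : 'rV[R]_6).

Local Notation half := (const_fun (2^-1 : R)).
Local Notation xc := (fun i : 'I_3 => coord_fun R (xi i)).
Local Notation yc := (fun i : 'I_3 => coord_fun R (yi i)).
Local Notation dxc := (fun i : 'I_3 => @der R (xi i)).
Local Notation dyc := (fun i : 'I_3 => @der R (yi i)).
Local Notation FX := (frameX half xc dxc dyc).
Local Notation FXhat := (frameXhat half xc dxc dyc).
Local Notation Frot := (rotation xc yc dxc dyc).
Local Notation sym := (symmetry_comb half xc yc dxc dyc).

Let halfD : half + half = 1.
Proof.
by rewrite -constD -const1 -[X in _ + X]mul1r -[X in X + _]mul1r -splitr.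
Qed.

Let derx i : derivation (dxc i). Proof. exact: derivation_der. Qed.
Let dery i : derivation (dyc i). Proof. exact: derivation_der. Qed.
Let dx_x i j : dxc i (xc j) = (i == j)%:R.
Proof. by rewrite /= der_coord eq_xi. Qed.
Let dx_y i j : dxc i (yc j) = 0.
Proof. by rewrite /= der_coord eq_xi_yi. Qed.
Let dy_x i j : dyc i (xc j) = 0.
Proof. by rewrite /= der_coord eq_sym eq_xi_yi. Qed.
Let dy_y i j : dyc i (yc j) = (i == j)%:R.
Proof. by rewrite /= der_coord eq_yi. Qed.
Let dxC i j F : dxc i (dxc j F) = dxc j (dxc i F). Proof. exact: derC. Qed.
Let dyC i j F : dyc i (dyc j F) = dyc j (dyc i F). Proof. exact: derC. Qed.
Let dydxC i j F : dyc i (dxc j F) = dxc j (dyc i F). Proof. exact: derC. Qed.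

Let valD F G p : val (F + G) p = val F p + val G p. Proof. by []. Qed.
Let valM F G p : val (F * G) p = val F p * val G p. Proof. by []. Qed.
Let valN F p : val (- F) p = - val F p. Proof. by []. Qed.
Let val_der j F p : val (der j F) p = partial j (val F) p. Proof. by []. Qed.
Let val_const c p : val (const_fun c) p = c. Proof. by []. Qed.
Let val_coord j p : val (coord_fun R j) p = p 0 j. Proof. by []. Qed.
Let valE := (valD, valM, valN, val_der, val_const, val_coord).

Lemma val_sum I (r : seq I) (G : I -> smooth_fun R) p :
  val (\sum_(i <- r) G i) p = \sum_(i <- r) val (G i) p.
Proof. by elim/big_ind2: _ => // F a G' b <- <-. Qed.

(** [lie X f p] depends on [X] only through [X p]; taking this vector as an argument exposes the
    linearity used to expand fields. *)
Let Lv (v : 'rV[R]_6) F p := \sum_(j < 6) v 0 j * partial j (val F) p.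

Let LvD v w F p : Lv (v + w) F p = Lv v F p + Lv w F p.
Proof.
by rewrite /Lv -big_split; apply: eq_bigr => j _; rewrite /= mxE mulrDl.
Qed.

Let LvZ c v F p : Lv (c *: v) F p = c * Lv v F p.
Proof. by rewrite /Lv mulr_sumr; apply: eq_bigr => j _; rewrite mxE mulrA. Qed.

Let LvN v F p : Lv (- v) F p = - Lv v F p.
Proof. by rewrite -scaleN1r LvZ mulN1r. Qed.

Let Lv_sum (v : 'I_3 -> 'rV[R]_6) F p :
  Lv (\sum_i v i) F p = \sum_i Lv (v i) F p.
Proof.
elim/big_ind2: _ => [|v1 a v2 b <- <-|//]; last exact: LvD.
by rewrite /Lv big1// => j _; rewrite mxE mul0r.
Qed.

Let Lv_evec j F p : Lv (evec R j) F p = partial j (val F) p.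
Proof.
rewrite /Lv (bigD1 j)//= mxE !eqxx mul1r big1 ?addr0// => k /negbTE kj.
by rewrite mxE kj mul0r.
Qed.

Let LvE := (LvD, LvZ, LvN, Lv_evec).

Lemma lie_X i F : lie (X_ i) (val F) = val (FX i F).
Proof.
apply/funext => p; rewrite -[LHS]/(Lv (X_ i p) F p) /X_ /dx /dy !LvE.
rewrite /frameX !valE /x_; ring.
Qed.

Lemma lie_Xhat i F : lie (Xhat_ i) (val F) = val (FXhat i F).
Proof.
apply/funext => p; rewrite -[LHS]/(Lv (Xhat_ i p) F p) /Xhat_ /dx /dy !LvE.
rewrite /frameXhat !valE /x_; ring.
Qed.

Lemma lie_theta i F : lie (theta_ i) (val F) = val (Frot i F).
Proof.
apply/funext => p; rewrite -[LHS]/(Lv (theta_ i p) F p) /theta_ /dx /dy !LvE.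
by rewrite /rotation !valE.
Qed.

Lemma lie_Y i F : lie (Y_ i) (val F) = val (dyc i F).
Proof.
by apply/funext => p; rewrite -[LHS]/(Lv (Y_ i p) F p) /Y_ /dy !LvE.
Qed.

Lemma sublaplacian_val F : sublaplacian (val F) = val (sum_squares FX F).
Proof.
apply/funext => p; rewrite /sublaplacian /sum_squares val_sum.
by apply: eq_bigr => i _; rewrite !lie_X.
Qed.

Lemma lie_coord X j p : lie X (val (coord_fun R j)) p = X p 0 j.
Proof.
rewrite /lie (bigD1 j)//= partial_coord eqxx mulr1 big1 ?addr0// => k.
move=> /negbTE kj.
by rewrite partial_coord kj mulr0.
Qed.

Lemma vfield_ext X X' :
    (forall j, lie X (val (coord_fun R j)) = lie X' (val (coord_fun R j))) ->
  X = X'.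
Proof.
move=> XX'; apply/funext => p; apply/rowP => j.
by rewrite -!lie_coord XX'.
Qed.

Lemma smooth_vfield_lie X (Z : smooth_fun R -> smooth_fun R) :
  (forall F, lie X (val F) = val (Z F)) -> smooth_vfield X.
Proof.
move=> XZ j; have -> : (fun p => X p 0 j) = val (Z (coord_fun R j)).
  by rewrite -XZ; apply/funext => p; rewrite lie_coord.
exact: smoothP.
Qed.

Lemma lie_frame (a b : 'I_3 -> smooth_fun R) F :
  lie (fun p => \sum_(i < 3) (val (a i) p *: X_ i p + val (b i) p *: Y_ i p))
    (val F) = val (\sum_i (a i * FX i F + b i * dyc i F)).
Proof.
apply/funext => p; rewrite val_sum.
rewrite -[LHS]/(Lv (\sum_(i < 3)
  (val (a i) p *: X_ i p + val (b i) p *: Y_ i p)) F p).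
rewrite Lv_sum; apply: eq_bigr => i _; rewrite LvD !LvZ valD !valM.
by rewrite -lie_X -lie_Y.
Qed.

Lemma lie_const_span (l m n : 'I_3 -> R) F :
  lie (fun p => \sum_(i < 3)
      (l i *: Xhat_ i p + m i *: theta_ i p + n i *: Y_ i p)) (val F) =
  val (sym (fun i => const_fun (l i)) (fun i => const_fun (m i))
           (fun i => const_fun (n i)) F).
Proof.
apply/funext => p; rewrite val_sum.
rewrite -[LHS]/(Lv (\sum_(i < 3)
  (l i *: Xhat_ i p + m i *: theta_ i p + n i *: Y_ i p)) F p).
rewrite Lv_sum; apply: eq_bigr => i _; rewrite LvD LvD !LvZ 2!valD !valM.
by rewrite -lie_Xhat -lie_theta -lie_Y.
Qed.

Lemma smooth_vfield_derivation X : smooth_vfield X ->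
  exists2 Z, derivation Z & forall F, lie X (val F) = val (Z F).
Proof.
move=> sX; exists (fun F => \sum_(j < 6) to_smooth (sX j) * der j F).
  split=> F G; [rewrite -big_split | rewrite mulr_suml mulr_sumr -big_split].
    by apply: eq_bigr => j _; rewrite (derivation_der R j).1 mulrDr.
  apply: eq_bigr => j _ /=; rewrite (derivation_der R j).2; ring.
by move=> F; apply/funext => p; rewrite val_sum.
Qed.

(** Every smooth function is the value of a ring element, so the operator identity and the ring
    identity test the same functions. *)
Lemma commutes_val X Z : (forall F, lie X (val F) = val (Z F)) ->
  commutes_with_sublaplacian X <->
  (forall F, sum_squares FX (Z F) = Z (sum_squares FX F)).
Proof.
move=> XZ.
have E F p : commutator (@sublaplacian R) (lie X) (val F) p =
    val (sum_squares FX (Z F)) p - val (Z (sum_squares FX F)) p.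
  by rewrite /commutator XZ !sublaplacian_val XZ.
split=> [cX F | cZ f sf p].
  apply: val_inj; apply/funext => p; apply/eqP; rewrite -subr_eq0 -E.
  by rewrite cX//; exact: smoothP.
by rewrite -[f]/(val (to_smooth sf)) E cZ subrr.
Qed.

(** The frame is unitriangular over the coordinate fields: [a i] is the [x_i] component, and [b k]
    is the [y_k] component minus the contribution of the horizontal fields. *)
Lemma in_frame_spanP X : in_frame_span X <-> smooth_vfield X.
Proof.
split=> [[a [b [sa sb ->]]] | sX].
  exact: smooth_vfield_lie (lie_frame (fun i => to_smooth (sa i))
                                      (fun i => to_smooth (sb i))).
pose C j := to_smooth (sX j).
pose b k := C (yi k) + half * C (xi (k + 1)) * xc (k + 2)
            - half * C (xi (k + 2)) * xc (k + 1).
exists (fun i => val (C (xi i))), (fun i => val (b i)).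
split=> [i|i|]; try exact: smoothP.
apply: vfield_ext => j; rewrite lie_frame.
have -> : lie X (val (coord_fun R j)) = val (C j).
  by apply/funext => p; rewrite lie_coord.
congr val; have [[k ->]|[k ->]] := index6P j.
- under eq_bigr do rewrite (frameX_x half dx_x dy_x) dy_x mulr0 addr0.
  by rewrite (sum_I3 _ k) eqxx !I3_eqE /=; ring.
- under eq_bigr do rewrite (frameX_y half xc dx_y dy_y) dy_y.
  by rewrite (sum_I3 _ k) !I3_addE eqxx !I3_eqE /= /b; ring.
Qed.

Lemma in_const_spanP X :
  in_const_span X <-> smooth_vfield X /\ commutes_with_sublaplacian X.
Proof.
split=> [[l [m [n ->]]] | [sX cX]].
  have E := lie_const_span l m n.
  split; first exact: smooth_vfield_lie E.
  apply/(commutes_val E) => F.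
  by apply: sublap_symmetry => // i k; rewrite !der_const.
have [Z derZ XZ] := smooth_vfield_derivation sX.
have [l [m [n [cl cm cn ZE]]]] := commuting_derivation halfD derx dery
  dx_x dx_y dy_x dy_y dxC dyC dydxC (@smooth_torsion_free R) derZ
  ((commutes_val XZ).1 cX).
(* Constants of the differential ring are real constants, recovered by evaluation at the origin. *)
have cst (c : 'I_3 -> smooth_fun R) : (forall i, dconstant dxc dyc (c i)) ->
    c = fun i => const_fun (val (c i) 0).
  move=> cc; apply/funext => i; apply: der_eq0_const => j.
  by have [[k ->]|[k ->]] := index6P j; have [] := cc i k.
exists (fun i => val (l i) 0), (fun i => val (m i) 0), (fun i => val (n i) 0).
apply: vfield_ext => j; rewrite lie_const_span -!cst// XZ; congr val.
by have [[k ->]|[k ->]] := index6P j; have [] := ZE k.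
Qed.

End SublaplacianSymmetries.

Theorem proposition2p1 (R : realType) :
  [set X : vfield R | smooth_vfield X /\ commutes_with_sublaplacian X] =
    [set X : vfield R | in_const_span X] /\
  [set X : vfield R | in_frame_span X /\ commutes_with_sublaplacian X] =
    [set X : vfield R | in_const_span X].
Proof.
split; apply/seteqP; split=> X /=.
- by move/in_const_spanP.
- by move/in_const_spanP.
(* Smooth frame coefficients amount to smooth components, which reduces the second equality to the
   first. *)
- by move=> [/in_frame_spanP sX cX]; apply/in_const_spanP.
- by move/in_const_spanP => [sX cX]; split=> //; apply/in_frame_spanP.
Qed.
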